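(* Let $\sigma$ be a finite relational signature and $d\in\mathbb{N}$. For every first-order $\sigma$-sentence $\varphi$ in $\Sigma_2$, the property $\mathcal{P}_\varphi:=\{\mathcal{A}\in\mathcal{C}_{\sigma,d}\mid \mathcal{A}\models\varphi\}$ is testable in the bounded-degree model for relational structures.
   Context: A $\sigma$-structure $\mathcal{A}$ consists of a finite universe $A$ and relations $R^{\mathcal{A}}\subseteq A^{\mathrm{ar}(R)}$ for $R\in\sigma$. The degree of an element is the number of tuples (over all relations) containing it; $\mathcal{C}_{\sigma,d}$ is the class of all $\sigma$-structures of degree at most $d$. A property is a subset of $\mathcal{C}_{\sigma,d}$ closed under isomorphism; $\mathcal{P}_n$ denotes its members with $n$ elements. For $\mathcal{A}$ with $n$ elements, $\mathrm{dist}(\mathcal{A},\mathcal{P}):=\min_{\mathcal{B}\in\mathcal{P}_n}\sum_{R\in\sigma}|R^{\mathcal{A}}\triangle R^{\mathcal{B}}|/(dn)$ (with $\mathcal{B}$ on the same universe); $\mathcal{A}$ is $\epsilon$-close to $\mathcal{P}$ if this is at most $\epsilon$, and $\epsilon$-far otherwise. An algorithm receives $n$ and oracle access to $\mathcal{A}$, whose elements are numbered $1,\dots,n$: a query $(a,i)$ with $i\le d$ returns the $i$-th tuple containing $a$ (in a fixed order) together with the relation it belongs to. An $\epsilon$-tester for $\mathcal{P}_n$ accepts every $\mathcal{A}\in\mathcal{P}_n$ with probability at least $2/3$ and rejects every $\mathcal{A}$ that is $\epsilon$-far from $\mathcal{P}_n$ with probability at least $2/3$. $\mathcal{P}$ is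 testable if for every $n$ and every $\epsilon\in(0,1)$ there is an $\epsilon$-tester for $\mathcal{P}_n$ making at most $q(\epsilon,d)$ queries, a bound independent of $n$. First-order logic is over $\sigma$ with equality; $\Sigma_2$ is the set of first-order formulas equivalent to one of the form $\exists x_1\dots\exists x_k\forall y_1\dots\forall y_\ell\,\psi$ with $\psi$ quantifier-free. *)

(* Defs.v *)
From HB Require Import structures.
From mathcomp Require Import all_boot all_order all_algebra.
From mathcomp Require Import reals constructive_ereal.

Set Implicit Arguments.
Unset Strict Implicit.
Unset Printing Implicit Defensive.

Import Order.TTheory GRing.Theory Num.Theory.

(* Arities are positive: a nullary relation would be invisible to the oracle,
   which only returns tuples containing a queried element. *)
Record signature := Signature {
  symb :> finType;
  ar : symb -> nat;
  ar_gt0 : forall r, 0 < ar r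
}.

Definition structure (s : signature) (T : finType) :=
  {dffun forall r : s, {set (ar r).-tuple T}}.

Definition fact (s : signature) (T : finType) :=
  {r : s & (ar r).-tuple T}.

Definition incident (s : signature) (T : finType) (A : structure s T) (a : T) :
    {set fact s T} :=
  [set f : fact s T | (tagged f \in A (tag f)) && (a \in tagged f)].

Definition degree_le (s : signature) (d : nat) (T : finType)
    (A : structure s T) : bool :=
  [forall a, #|incident A a| <= d].

Definition isomorphism (s : signature) (T U : finType)
    (A : structure s T) (B : structure s U) (h : T -> U) : Prop :=
  bijective h /\
  forall (r : s) (t : (ar r).-tuple T), (map_tuple h t \in B r) = (t \in A r).

Record property (s : signature) (d : nat) := Property {
  members :> forall T : finType, pred (structure s T);
  members_degree : forall (T : finType) (A : structure s T),
    members A -> degree_le d A;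
  members_iso : forall (T U : finType) (A : structure s T) (B : structure s U)
    (h : T -> U), isomorphism A B h -> members A -> members B
}.

Definition diff_size (s : signature) (T : finType) (A B : structure s T) : nat :=
  \sum_(r : s) #|(A r :\: B r) :|: (B r :\: A r)|.

(* The minimum over the empty set is +oo: every structure is far from an empty
   property. When d * #|T| = 0 there is only one structure of degree at most d
   on T, and the quotient below is 0 / 0 = 0. *)
Definition dist (R : realType) (s : signature) (d : nat) (P : property s d)
    (T : finType) (A : structure s T) : \bar R :=
  \big[Order.min/+oo%E]_(B : structure s T | P T B)
    ((diff_size A B)%:R / (d * #|T|)%:R)%R%:E.

Definition eps_close (R : realType) (eps : R) (s : signature) (d : nat)
    (P : property s d) (T : finType) (A : structure s T) : bool :=
  (dist R P A <= eps%:E)%E.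

Definition eps_far (R : realType) (eps : R) (s : signature) (d : nat)
    (P : property s d) (T : finType) (A : structure s T) : bool :=
  ~~ eps_close eps P A.

(* Randomized algorithms with oracle access to a structure of degree at most d
   on n elements. [Query a i k] continues with [k None] when a is contained in
   at most i tuples (indices start at 0), and [Sample m k] draws an element of
   'I_m.+1 uniformly, independently of all previous draws. *)
Inductive algorithm (s : signature) (d n : nat) : Type :=
  | Output of bool
  | Query of 'I_n & 'I_d & (option (fact s 'I_n) -> algorithm s d n)
  | Sample m of ('I_m.+1 -> algorithm s d n).

(* The input of an algorithm: for every element, the tuples containing it,
   listed in an arbitrary order. *)
Definition listing (s : signature) (n : nat) := 'I_n -> seq (fact s 'I_n).

Definition listing_of (s : signature) (n : nat) (A : structure s 'I_n)
    (L : listing s n) : Prop :=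
  forall a, perm_eq (L a) (enum (incident A a)).

Fixpoint outcome_prob (s : signature) (d n : nat) (L : listing s n) (b : bool)
    (M : algorithm s d n) : rat :=
  match M with
  | Output c => (c == b)%:R%R
  | Query a i k => outcome_prob L b (k (onth (L a) i))
  | Sample m k => ((\sum_(j < m.+1) outcome_prob L b (k j)) / m.+1%:R)%R
  end.

Fixpoint num_queries (s : signature) (d n : nat) (L : listing s n)
    (M : algorithm s d n) : nat :=
  match M with
  | Output _ => 0
  | Query a i k => (num_queries L (k (onth (L a) i))).+1
  | Sample m k => \max_(j < m.+1) num_queries L (k j)
  end.

Definition tester (R : realType) (eps : R) (s : signature) (d : nat)
    (P : property s d) (n : nat) (M : algorithm s d n) : Prop :=
  forall (A : structure s 'I_n) (L : listing s n),
    degree_le d A -> listing_of A L ->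
    (P _ A -> (2%:R / 3%:R <= outcome_prob L true M)%R) /\
    (eps_far eps P A -> (2%:R / 3%:R <= outcome_prob L false M)%R).

Definition testable (R : realType) (s : signature) (d : nat)
    (P : property s d) : Prop :=
  exists q : R -> nat, forall (n : nat) (eps : R), (0 < eps < 1)%R ->
    exists M : algorithm s d n,
      tester eps P M /\
      forall (A : structure s 'I_n) (L : listing s n),
        degree_le d A -> listing_of A L -> num_queries L M <= q eps.

(* Formulas with free variables among 'I_k; under a quantifier the bound
   variable is 0 and the other variables are shifted by 1. *)
Inductive formula (s : signature) : nat -> Type :=
  | FEq k of 'I_k & 'I_k : formula s k
  | FRel k (r : s) of (ar r).-tuple 'I_k : formula s k
  | FNot k of formula s k : formula s k
  | FAnd k of formula s k & formula s k : formula s k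
  | FOr k of formula s k & formula s k : formula s k
  | FEx k of formula s k.+1 : formula s k
  | FAll k of formula s k.+1 : formula s k.

Definition sentence (s : signature) := formula s 0.

Fixpoint sat (s : signature) (T : finType) (A : structure s T) (k : nat)
    (f : formula s k) : k.-tuple T -> bool :=
  match f in formula _ k return k.-tuple T -> bool with
  | FEq _ x y => fun v => tnth v x == tnth v y
  | FRel _ r t => fun v => map_tuple (tnth v) t \in A r
  | FNot _ g => fun v => ~~ sat A g v
  | FAnd _ g h => fun v => sat A g v && sat A h v
  | FOr _ g h => fun v => sat A g v || sat A h v
  | FEx _ g => fun v => [exists x, sat A g (cons_tuple x v)]
  | FAll _ g => fun v => [forall x, sat A g (cons_tuple x v)]
  end.

Definition models (s : signature) (T : finType) (A : structure s T)
    (phi : sentence s) : bool := sat A phi [tuple].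

Fixpoint quantifier_free (s : signature) (k : nat) (f : formula s k) : bool :=
  match f with
  | FEq _ _ _ | FRel _ _ _ => true
  | FNot _ g => quantifier_free g
  | FAnd _ g h | FOr _ g h => quantifier_free g && quantifier_free h
  | FEx _ _ | FAll _ _ => false
  end.

Fixpoint forall_prefix (s : signature) (k : nat) (f : formula s k) : bool :=
  if f is FAll _ g then forall_prefix g else quantifier_free f.

Fixpoint exists_forall_prefix (s : signature) (k : nat) (f : formula s k) :
    bool :=
  if f is FEx _ g then exists_forall_prefix g else forall_prefix f.

(* The structures of interest are finite, so equivalence is over finite
   structures; as usual in logic, only nonempty ones count. *)
Definition Sigma2 (s : signature) (phi : sentence s) : Prop :=
  exists2 psi : sentence s, exists_forall_prefix psi &
    forall (T : finType) (A : structure s T),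
      0 < #|T| -> models A phi = models A psi.

Lemma isomorphism_sat (s : signature) (T U : finType)
    (A : structure s T) (B : structure s U)
    (h : T -> U) (k : nat) (f : formula s k) (v : k.-tuple T) :
  isomorphism A B h -> sat B f (map_tuple h v) = sat A f v.
Proof.
case=> -[g hK gK] hAB.
have consE m (w : m.-tuple T) x :
    cons_tuple (h x) (map_tuple h w) = map_tuple h (cons_tuple x w).
  exact: val_inj.
elim: f v => {k} [k x y|k r t|k f IH|k f IH f' IH'|k f IH f' IH'|k f IH|k f IH]
  v /=; rewrite ?IH ?IH' //.
- by rewrite !tnth_map (can_eq hK).
- rewrite -hAB; suff -> : map_tuple (tnth (map_tuple h v)) t =
      map_tuple h (map_tuple (tnth v) t) by [].
  apply: eq_from_tnth => i.
  by rewrite !tnth_map.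
- apply/existsP/existsP => -[x fx]; last by exists (h x); rewrite consE IH.
  by exists (g x); rewrite -IH -consE gK.
- apply/forallP/forallP => fx x; first by rewrite -IH -consE.
  by rewrite -[x]gK consE IH.
Qed.

Lemma isomorphism_degree (s : signature) (d : nat) (T U : finType)
    (A : structure s T) (B : structure s U) (h : T -> U) :
  isomorphism A B h -> degree_le d A -> degree_le d B.
Proof.
case=> -[g hK gK] hAB /forallP dA; apply/forallP => b.
apply: leq_trans (dA (g b)).
pose G (f : fact s U) : fact s T :=
  Tagged (fun r : s => (ar r).-tuple T) (map_tuple g (tagged f)).
have G_inj : injective G.
  apply: (can_inj (g := fun f : fact s T =>
    Tagged (fun r : s => (ar r).-tuple U) (map_tuple h (tagged f)))).
  case=> r t; rewrite /G /=; congr Tagged; apply: eq_from_tnth => i.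
  by rewrite !tnth_map gK.
rewrite -(card_imset _ G_inj); apply/subset_leq_card/subsetP => _ /imsetP[f + ->].
rewrite !inE /= => /andP[fB bf]; rewrite map_f // andbT -hAB.
suff -> : map_tuple h (map_tuple g (tagged f)) = tagged f by [].
by apply: eq_from_tnth => i; rewrite !tnth_map gK.
Qed.

Definition models_pred (s : signature) (d : nat) (phi : sentence s)
    (T : finType) : pred (structure s T) :=
  fun A => degree_le d A && models A phi.

Lemma models_degree (s : signature) (d : nat) (phi : sentence s)
    (T : finType) (A : structure s T) :
  models_pred d phi A -> degree_le d A.
Proof. by case/andP. Qed.

Lemma models_iso (s : signature) (d : nat) (phi : sentence s)
    (T U : finType) (A : structure s T) (B : structure s U) (h : T -> U) :
  isomorphism A B h -> models_pred d phi A -> models_pred d phi B.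
Proof.
move=> iso /andP[dA mA]; apply/andP; split.
  exact: isomorphism_degree iso dA.
rewrite /models -(_ : map_tuple h [tuple] = [tuple]); last exact: val_inj.
by rewrite (isomorphism_sat _ _ iso).
Qed.

Definition models_property (s : signature) (d : nat) (phi : sentence s) :
    property s d :=
  Property (@models_degree s d phi) (@models_iso s d phi).

(* Main.v *)
Require Import Defs.
From mathcomp Require Import all_boot all_order all_algebra.
From mathcomp Require Import boolp reals constructive_ereal.
From mathcomp Require Import zify lra.

(** Write the sentence as [exists x, forall y, chi] with [chi] quantifier-free,
    [m] variables in all, and record for every element [a] the set [feat a] of
    atomic types of the [m]-tuples inside the [m]-ball of [a]. Call a set [U] of
    types good if some bounded-degree pattern for [x], placed as an isolated
    part next to any structure all of whose local types lie in [U], witnesses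
    the sentence.

    If [A] is a model, the types occurring at many elements of [A] form a good
    set: the connected parts of a tuple [y] over such types can be embedded in
    [A] one after the other, far away from each other and from the witness.
    Conversely, if [U] is good and only few elements [a] violate
    [feat a \subset U], then [A] becomes a model by editing only tuples at these
    elements and at those carrying the pattern: every violating element is cut
    off and given the loops of one fixed non-violating element. Hence, for large
    [n], it suffices to sample constantly many elements and to accept when the
    union of their features is good; for small [n] the whole input is read. *)

Set Implicit Arguments.
Unset Strict Implicit.
Unset Printing Implicit Defensive.

Import Order.TTheory GRing.Theory Num.Theory.

(** * Quantifier prefixes and their quantifier-free matrix *)

Section Prefix.
Variable s : signature.

Lemma suffix_exists_cons (T : eqType) (v w : seq T) :
  size v < size w -> suffix v w -> exists x, suffix (x :: v) w.
Proof.
move=> lt_vw /suffixP[u def_w]; case/lastP: u def_w => [|u x] def_w.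
  by rewrite def_w ltnn in lt_vw.
by exists x; rewrite def_w cat_rcons suffix_suffix.
Qed.

Lemma suffix_behead (T : eqType) x (v w : seq T) :
  suffix (x :: v) w -> suffix v w.
Proof. by move/suffixP=> [u ->]; rewrite -cat_rcons suffix_suffix. Qed.

(** Each quantifier conses its variable in front of the valuation, so after the whole block the old
    valuation is a suffix of the valuation of the matrix. Quantifying over all [w] with suffix [v]
    therefore replaces the block at once. *)
Lemma forall_prefix_matrix (k : nat) (f : formula s k) : forall_prefix f ->
  exists m (chi : formula s m), [/\ k <= m, quantifier_free chi &
    forall (T : finType) (A : structure s T) (v : k.-tuple T),
      sat A f v <-> forall w : m.-tuple T, suffix v w -> sat A chi w].
Proof.
have base k' (f' : formula s k') : quantifier_free f' ->
  exists m (chi : formula s m), [/\ k' <= m, quantifier_free chi &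
    forall (T : finType) (A : structure s T) (v : k'.-tuple T),
      sat A f' v <-> forall w : m.-tuple T, suffix v w -> sat A chi w].
  move=> qf; exists k', f'; split=> // T A v; split=> [fv w|]; last first.
    by apply; rewrite suffix_refl.
  move/suffixP=> [u]; case: u => [|x u] /= vw.
    by rewrite (_ : w = v) //; apply: val_inj.
  have /eqP : size w = size (x :: u ++ v) by rewrite -vw.
  by rewrite /= size_cat !size_tuple; lia.
elim: f => {k} [k x y|k r t|k f IH|k f IH f' IH'|k f IH f' IH'|k f IH|k f IH];
  try by move=> H; apply: base.
move=> /= /IH[m [chi [km qf E]]]; exists m, chi; split=> //; first exact: ltnW.
move=> T A v /=; split=> [/forallP H w vw|H].
  have [|x xvw] := suffix_exists_cons _ vw; first by rewrite !size_tuple.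
  exact/(E T A (cons_tuple x v)).1.
by apply/forallP => x; apply/E => w /suffix_behead; apply: H.
Qed.

Lemma exists_forall_prefix_matrix (psi : sentence s) :
  exists_forall_prefix psi ->
  exists k (f : formula s k), forall_prefix f /\
    forall (T : finType) (A : structure s T),
      models A psi <-> exists v : k.-tuple T, sat A f v.
Proof.
suff H j (g : formula s j) : exists_forall_prefix g ->
  exists k (f : formula s k), [/\ j <= k, forall_prefix f &
    forall (T : finType) (A : structure s T) (v : j.-tuple T),
      sat A g v <-> exists2 w : k.-tuple T, suffix v w & sat A f w].
  move=> /H[k [f [_ fp E]]]; exists k, f; split=> // T A.
  split=> [/E[w _ fw]|[w fw]]; first by exists w.
  by apply/E; exists w; rewrite ?suffix0s.
have base k' (f' : formula s k') : forall_prefix f' ->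
  exists k (f : formula s k), [/\ k' <= k, forall_prefix f &
    forall (T : finType) (A : structure s T) (v : k'.-tuple T),
      sat A f' v <-> exists2 w : k.-tuple T, suffix v w & sat A f w].
  move=> fp; exists k', f'; split=> // T A v; split=> [fv|[w]].
    by exists v; rewrite ?suffix_refl.
  move/suffixP=> [u]; case: u => [|x u] /= vw.
    by rewrite (_ : w = v) //; apply: val_inj.
  have /eqP : size w = size (x :: u ++ v) by rewrite -vw.
  by rewrite /= size_cat !size_tuple; lia.
elim: g => {j} [k x y|k r t|k f IH|k f IH f' IH'|k f IH f' IH'|k f IH|k f IH];
  try by move=> H; apply: base.
move=> /= /IH[m [chi [km qf E]]]; exists m, chi; split=> //; first exact: ltnW.
move=> T A v /=; split=> [/existsP[x /E[w vw cw]]|[w vw cw]].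
  by exists w => //; apply: suffix_behead vw.
have [|x xvw] := suffix_exists_cons _ vw; first by rewrite !size_tuple.
by apply/existsP; exists x; apply/E; exists w.
Qed.

End Prefix.

(** * Adjacency and balls in structures of bounded degree *)

Section Locality.
Variables (s : signature) (T : finType).
Implicit Types (A : structure s T) (X Y : {set T}) (x y : T).

(** Made reflexive so that balls increase with the radius and equal entries of a tuple count as
    connected. *)
Definition adj A x y : bool :=
  (x == y) || [exists f in incident A x, y \in tagged f].

Definition neigh A X : {set T} := [set y | [exists x in X, adj A x y]].

Definition ball A r X : {set T} := iter r (neigh A) X.

Lemma adjP A x y :
  reflect (x = y \/ exists (r : s) (t : (ar r).-tuple T),
             [/\ t \in A r, x \in t & y \in t]) (adj A x y).
Proof.
apply: (iffP orP) => [[/eqP->|/existsP[[r t]]]|[->|[r [t [tA xt yt]]]]].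
- by left.
- by rewrite inE /= => /andP[/andP[tA xt] yt]; right; exists r, t.
- by left.
- right; apply/existsP; exists (existT _ r t : fact s T).
  by rewrite inE /= tA xt.
Qed.

Lemma adj_refl A x : adj A x x. Proof. by rewrite /adj eqxx. Qed.

Lemma adj_sym A x y : adj A x y = adj A y x.
Proof.
by apply/adjP/adjP => -[->|[r [t [? ? ?]]]]; try (by left); right; exists r, t.
Qed.

Lemma neighP A X y :
  reflect (exists2 x, x \in X & adj A x y) (y \in neigh A X).
Proof. by rewrite inE; apply: exists_inP. Qed.

Lemma ballS A r X : ball A r.+1 X = neigh A (ball A r X). Proof. by []. Qed.

Lemma ballSr A r X : ball A r.+1 X = ball A r (neigh A X).
Proof. exact: iterSr. Qed.

Lemma neigh_mono A X Y : X \subset Y -> neigh A X \subset neigh A Y.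
Proof.
move=> /subsetP XY; apply/subsetP => y /neighP[x xX xy].
by apply/neighP; exists x => //; apply: XY.
Qed.

Lemma ball_mono A r X Y : X \subset Y -> ball A r X \subset ball A r Y.
Proof. by move=> XY; elim: r => //= r; apply: neigh_mono. Qed.

Lemma sub_neigh A X : X \subset neigh A X.
Proof. by apply/subsetP => x xX; apply/neighP; exists x; rewrite ?adj_refl. Qed.

Lemma ball_leq A r r' X : r <= r' -> ball A r X \subset ball A r' X.
Proof.
move/subnKC <-; elim: (r' - r) => [|i IH]; first by rewrite addn0.
by rewrite addnS ballS; apply: subset_trans IH (sub_neigh _ _).
Qed.

Lemma ball_sym A r x y : y \in ball A r [set x] -> x \in ball A r [set y].
Proof.
elim: r x y => [|r IH] x y; first by rewrite !inE eq_sym.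
rewrite ballS => /neighP[z zr zy]; rewrite ballSr.
apply: subsetP (IH _ _ zr); apply: ball_mono; rewrite sub1set.
by apply/neighP; exists y; rewrite ?set11 // adj_sym.
Qed.

(** Bounds a closed neighbourhood: the element itself and the entries of at most [d] tuples. *)
Definition growth (d : nat) : nat := (d * \max_(r : s) ar r).+1.

Lemma leq_card_bigcup_const (I U : finType) (X : {set I}) (F : I -> {set U}) c :
  (forall i, i \in X -> #|F i| <= c) -> #|\bigcup_(i in X) F i| <= #|X| * c.
Proof.
move=> H; rewrite -sum_nat_const.
elim/big_rec2: _ => [|i n Y iX le]; first by rewrite cards0.
by apply: leq_trans (leq_card_setU _ _) _; apply: leq_add => //; apply: H.
Qed.

Lemma card_neigh d A X : degree_le d A -> #|neigh A X| <= #|X| * growth d.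
Proof.
move/forallP=> dA.
apply: leq_trans (leq_card_bigcup_const (F := fun x => x |:
  \bigcup_(f in incident A x) [set y in tagged f]) _).
  apply/subset_leq_card/subsetP => y /neighP[x xX xy]; apply/bigcupP.
  exists x => //; case/orP: xy => [/eqP->|/existsP[f /andP[fx yf]]].
    exact: setU11.
  by apply/setU1P; right; apply/bigcupP; exists f => //; rewrite inE.
move=> x _; apply: leq_trans (leq_card_setU _ _) _; rewrite cards1 add1n ltnS.
apply: leq_trans (leq_card_bigcup_const (c := \max_(r : s) ar r) _) _;
  last first.
  by rewrite leq_mul2r dA orbT.
move=> f _; rewrite cardsE; apply: leq_trans (card_size _) _.
by rewrite size_tuple (leq_bigmax (tag f)).
Qed.

Lemma card_ball d A r X :
  degree_le d A -> #|ball A r X| <= #|X| * growth d ^ r.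
Proof.
move=> dA; elim: r => [|r IH]; first by rewrite muln1.
rewrite ballS expnSr mulnA; apply: leq_trans (card_neigh _ dA) _.
by rewrite leq_mul2r IH orbT.
Qed.

End Locality.

(** * Atomic diagrams of tuples: gluing and transport *)

Section Diagrams.
Variable s : signature.

(** The map from [tnth v i] to [tnth w i], for [i] in [P], is a partial isomorphism. *)
Definition agree (k : nat) (P : pred 'I_k) (T U : finType) (A : structure s T)
    (v : k.-tuple T) (B : structure s U) (w : k.-tuple U) : Prop :=
  (forall i j, P i -> P j ->
     (tnth v i == tnth v j) = (tnth w i == tnth w j)) /\
  (forall (r : s) (t : (ar r).-tuple 'I_k), all P t ->
     (map_tuple (tnth v) t \in A r) = (map_tuple (tnth w) t \in B r)).

Lemma agree_sat (k : nat) (chi : formula s k) (T U : finType)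
    (A : structure s T) (v : k.-tuple T) (B : structure s U) (w : k.-tuple U) :
  quantifier_free chi -> agree predT A v B w -> sat A chi v = sat B chi w.
Proof.
move=> qf [eqvw relvw].
elim: chi qf v w eqvw relvw =>
    {k} [k x y|k r t|k f IH|k f IH f' IH'|k f IH f' IH'|k f IH|k f IH] //=
    qf v w e r'.
- exact: e.
- by apply: r'; rewrite all_predT.
- by rewrite (IH _ v w).
- by case/andP: qf => qf qf'; rewrite (IH _ v w) // (IH' _ v w).
- by case/andP: qf => qf qf'; rewrite (IH _ v w) // (IH' _ v w).
Qed.

(** Positivity of arities enters here: every tuple can be attributed to one of its entries. *)
Lemma ar_tuple_ex (T : finType) (r : s) (t : (ar r).-tuple T) :
  exists x, x \in t.
Proof.
by exists (tnth t (Ordinal (ar_gt0 r))); rewrite mem_tnth.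
Qed.

(** Equal entries are adjacent, and so are entries of a common tuple, hence they carry equal labels.
    Across different labels both structures thus have no equalities and no tuples to compare. *)
Lemma agree_glue (m : nat) (L : eqType) (q : 'I_m -> L) (T U : finType)
    (A : structure s T) (v : m.-tuple T) (B : structure s U) (w : m.-tuple U) :
  (forall i j, adj A (tnth v i) (tnth v j) -> q i = q j) ->
  (forall i j, adj B (tnth w i) (tnth w j) -> q i = q j) ->
  (forall c, agree [pred i | q i == c] A v B w) ->
  agree predT A v B w.
Proof.
move=> qA qB loc; split=> [i j _ _|r t _].
  have [qij|qij] := eqVneq (q i) (q j).
    by apply: (loc (q j)).1; apply/eqP.
  apply/eqP/eqP => eij; case/eqP: qij; [apply: qA|apply: qB];
    by rewrite eij adj_refl.
have [i0 i0t] := ar_tuple_ex t.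
have [/(loc (q i0)).2 //|/allPn[i it /= qi]] :=
  boolP (all [pred i | q i == q i0] t).
by apply/idP/idP => tin; case/eqP: qi; [apply: qA|apply: qB]; apply/adjP; right;
  exists r; eexists; split; try (exact: tin); apply: map_f.
Qed.

(** [h] sends an entry of [b] to the entry of [a] at its first index; repetitions are harmless
    because both tuples have the same equalities. [x0] is the value outside [b]. *)
Lemma agree_transport (k : nat) (T U : finType) (A : structure s T)
    (a : k.-tuple T) (B : structure s U) (b : k.-tuple U) (x0 : T) :
  agree predT A a B b ->
  exists h : U -> T, [/\ forall i, h (tnth b i) = tnth a i,
    {in b &, injective h} &
    forall (r : s) (u : (ar r).-tuple U), {subset u <= b} ->
      (map_tuple h u \in A r) = (u \in B r)].
Proof.
move=> [eqab relab]; pose h x := nth x0 a (index x b); exists h.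
have hb i : h (tnth b i) = tnth a i.
  have lt : index (tnth b i) b < k.
    by rewrite -[X in _ < X](size_tuple b) index_mem mem_tnth.
  rewrite /h -[index _ _]/(val (Ordinal lt)) -tnth_nth.
  by apply/eqP; rewrite eqab // (tnth_nth (tnth b i)) nth_index ?mem_tnth.
split=> //.
  move=> _ _ /tnthP[i ->] /tnthP[j ->]; rewrite !hb => /eqP.
  by rewrite eqab // => /eqP.
move=> r u ub.
have [x xu] := ar_tuple_ex u.
have /tnthP[j0 _] := ub _ xu.
pose J x := odflt j0 [pick j | x == tnth b j].
have JK y : y \in u -> tnth b (J y) = y.
  move=> /ub/tnthP[j yj]; rewrite /J; case: pickP => [i /eqP->//|/(_ j)].
  by rewrite yj eqxx.
have -> : u = map_tuple (tnth b) (map_tuple J u).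
  by apply: eq_from_tnth => i; rewrite !tnth_map JK // mem_tnth.
rewrite -relab ?all_predT //.
apply: (congr1 (fun z => z \in A r)); apply: eq_from_tnth => i.
by rewrite !tnth_map hb.
Qed.

End Diagrams.

(** * Atomic types, features and good sets of types *)

Section Types.
Variables (s : signature) (m : nat).

(** Relations are pulled back to the indices, which gives a finite set of types depending on [s] and
    [m] only, so its cardinality may enter bounds independent of the input size. *)
Definition mtype : finType :=
  ({ffun 'I_m * 'I_m -> bool} * structure s 'I_m)%type.

Definition typ (T : finType) (A : structure s T) (w : m.-tuple T) : mtype :=
  ([ffun p => tnth w p.1 == tnth w p.2],
   [ffun r : s => [set t : (ar r).-tuple 'I_m | map_tuple (tnth w) t \in A r]]).

Lemma typP (T U : finType) (A : structure s T) (v : m.-tuple T)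
    (B : structure s U) (w : m.-tuple U) :
  typ A v = typ B w <-> agree predT A v B w.
Proof.
split=> [[/ffunP e /ffunP h]|[e h]].
  split=> [i j _ _|r t _]; first by have := e (i, j); rewrite !ffunE.
  by have /setP/(_ t) := h r; rewrite !ffunE !inE.
congr pair; first by apply/ffunP => -[i j]; rewrite !ffunE e.
by apply/ffunP => r; rewrite !ffunE; apply/setP => t; rewrite !inE h ?all_predT.
Qed.

(** Radius [m] is enough for a connected part of an [m]-tuple to lie in the ball of each of its
    elements. *)
Definition feat (T : finType) (A : structure s T) (a : T) : {set mtype} :=
  [set ty | [exists w : m.-tuple T,
    all (mem (ball A m [set a])) w && (typ A w == ty)]].

Lemma featP (T : finType) (A : structure s T) (a : T) (ty : mtype) :
  reflect (exists2 w : m.-tuple T,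
             {subset w <= ball A m [set a]} & typ A w = ty)
          (ty \in feat A a).
Proof.
rewrite inE; apply: (iffP existsP) => [[w /andP[/allP ? /eqP ?]]|[w wa <-]].
  by exists w.
by exists w; rewrite eqxx andbT; apply/allP.
Qed.

Definition frequent (C : nat) (T : finType) (A : structure s T) : {set mtype} :=
  [set ty | C < #|[set a | ty \in feat A a]|].

Lemma card_infrequent (C : nat) (T : finType) (A : structure s T) :
  #|[set a | ~~ (feat A a \subset frequent C A)]| <= #|mtype| * C.
Proof.
apply: leq_trans (_ : #|\bigcup_(ty in ~: frequent C A)
  [set a | ty \in feat A a]| <= _).
  apply/subset_leq_card/subsetP => a; rewrite inE => /subsetPn[ty tya tyf].
  by apply/bigcupP; exists ty; rewrite inE.
apply: leq_trans (leq_card_bigcup_const (c := C) _) _.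
  by move=> ty; rewrite !inE -leqNgt.
by rewrite leq_mul2r max_card orbT.
Qed.

(** More than [C] elements have [ty] in their feature, but at most [C] lie in the ball of radius
    [m.+1] around [Y]. Around an element outside that ball, a realization of [ty] within distance
    [m] cannot touch a neighbour of [Y]. *)
Lemma frequent_far d C (T : finType) (A : structure s T) (Y : {set T}) ty :
  degree_le d A -> ty \in frequent C A -> #|Y| * growth s d ^ m.+1 <= C ->
  exists2 w : m.-tuple T, typ A w = ty &
    forall p x, p \in Y -> x \in w -> ~~ adj A p x.
Proof.
move=> dA; rewrite inE => lt le.
have : ~~ ([set a | ty \in feat A a] \subset ball A m.+1 Y).
  apply/negP => /subset_leq_card le'.
  have := leq_trans lt (leq_trans le' (leq_trans (card_ball _ _ dA) le)).
  by rewrite ltnn.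
case/subsetPn=> a; rewrite inE => /featP[w wa <-] aY; exists w => // p x pY xw.
apply: contra aY => px; rewrite ballSr.
apply: subsetP (ball_sym (wa _ xw)); apply: ball_mono; rewrite sub1set.
by apply/neighP; exists p.
Qed.

(** Greedy choice: the entries of each chosen tuple are added to [Y], so later tuples avoid them.
    [K] bounds the size of [Y] throughout. *)
Lemma frequent_scattered d K C (I : eqType) (l : seq I) (g : I -> mtype)
    (T : finType) (A : structure s T) (x0 : T) (Y : {set T}) :
  degree_le d A -> uniq l -> (forall i, i \in l -> g i \in frequent C A) ->
  #|Y| + m * size l <= K -> K * growth s d ^ m.+1 <= C ->
  exists W : I -> m.-tuple T,
    [/\ forall i, i \in l -> typ A (W i) = g i,
        forall i p x, i \in l -> p \in Y -> x \in W i -> ~~ adj A p x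
      & forall i j x y, i \in l -> j \in l -> i != j ->
          x \in W i -> y \in W j -> ~~ adj A x y].
Proof.
move=> dA + + + KC.
elim: l Y => [|i l IH] Y; first by exists (fun=> nseq_tuple m x0); split.
move=> /= /andP[il ul] gf le.
have [||w tw wY] := @frequent_far d C T A Y (g i) dA.
- by apply: gf; rewrite inE eqxx.
- by apply: leq_trans KC; rewrite leq_mul2r; apply/orP; right; lia.
have [||| W [W1 W2 W3]] := IH (Y :|: [set x in w]) => //.
- by move=> j jl; apply: gf; rewrite inE jl orbT.
- apply: leq_trans le; rewrite mulnS addnA leq_add2r.
  apply: leq_trans (leq_card_setU _ _) _; rewrite leq_add2l cardsE.
  by apply: leq_trans (card_size _) _; rewrite size_tuple.
exists (fun j => if j == i then w else W j).
split=> [j|j p x|j j' x y]; rewrite !inE.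
- by case: eqP => [->//|_ /=]; apply: W1.
- case: eqP => [_ _|_ /= jl] pY; first exact: wY.
  by apply: W2; rewrite // inE pY.
- case: eqP => [->|_] /=; case: eqP => [->|_] //=; rewrite ?eqxx //.
  + by move=> _ jl _ xw yW; apply: (W2 j') => //; rewrite !inE xw orbT.
  + move=> jl _ _ xw yW; rewrite adj_sym; apply: (W2 j) => //.
    by rewrite !inE yW orbT.
  + by move=> jl jl'; apply: W3.
Qed.

Definition isolated (k : nat) (T : finType) (B : structure s T)
    (b : k.-tuple T) : Prop :=
  forall x y, adj B x y -> (x \in b) = (y \in b).

(** The pattern comes from a structure of bounded degree, so planting it respects the degree bound;
    [B] ranges over all finite structures, so goodness does not depend on the input size. *)
Definition good d k (f : formula s k) (U : {set mtype}) : Prop :=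
  exists (T0 : finType) (A0 : structure s T0) (a0 : k.-tuple T0),
  [/\ 0 < #|T0|, degree_le d A0
    & forall (T : finType) (B : structure s T) (b : k.-tuple T),
        isolated B b -> agree predT A0 a0 B b ->
        (forall x, x \notin b -> feat B x \subset U) -> sat B f b].

Lemma good_sub d k (f : formula s k) (U V : {set mtype}) :
  U \subset V -> good d f V -> good d f U.
Proof.
move=> UV [T0 [A0 [a0 [T0_gt0 dA0 H]]]]; exists T0, A0, a0.
split=> // T B b iB ab Bb.
by apply: H => // x xb; apply: subset_trans (Bb _ xb) UV.
Qed.

Lemma connect_ball (T : finType) (B : structure s T) (w : m.-tuple T)
    (e : rel 'I_m) i j :
  (forall i j, e i j -> adj B (tnth w i) (tnth w j)) -> connect e i j ->
  tnth w j \in ball B m [set tnth w i].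
Proof.
move=> eB /connectP[p /shortenP[p' ep' up' _] ->].
(* A path without repetitions visits at most [m] indices. *)
have lep : size p' <= m.
  have := max_card (mem (i :: p')).
  by rewrite (card_uniqP up') card_ord => /ltnW.
apply: subsetP (ball_leq _ _ lep) _ _.
elim/last_ind: p' ep' {up' lep} => [|p' x IH]; first by rewrite inE.
rewrite rcons_path last_rcons size_rcons => /andP[/IH pB ex].
by apply/neighP; eexists; [exact: pB | exact: eB].
Qed.

(** The witness [a] in [A] is its own pattern. A tuple [w'] of [B] splits into connected parts:
    those meeting [b] lie inside [b], which is isolated, and are copied to [a]; the others have
    frequent types and are copied to scattered places of [A]. The copy has the atomic type of [w'],
    and [A] satisfies [chi] there. The bound on [C] leaves room for [k] entries of [a] and at most
    [m] parts of [m] entries. *)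
Lemma good_frequent d C k (f : formula s k) (chi : formula s m)
    (T : finType) (A : structure s T) (a : k.-tuple T) :
  k <= m -> quantifier_free chi ->
  (forall (T : finType) (A : structure s T) (v : k.-tuple T),
     sat A f v <-> forall w : m.-tuple T, suffix v w -> sat A chi w) ->
  (k + m * m) * growth s d ^ m.+1 <= C ->
  0 < #|T| -> degree_le d A -> sat A f a -> good d f (frequent C A).
Proof.
move=> km qf fE leC T_gt0 dA fa; exists T, A, a; split=> // U B b iB ab Bb.
have [x0 _] := card_gt0P T_gt0.
apply/fE => w' /suffixP[y' def_w'].
have [h [hb h_inj hrel]] := agree_transport x0 ab.
pose e : rel 'I_m := [rel i j | adj B (tnth w' i) (tnth w' j)].
have e_sym : connect_sym e by apply: sym_connect_sym => i j; apply: adj_sym.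
have eb i j : connect e i j -> (tnth w' i \in b) = (tnth w' j \in b).
  move=> /connectP[p ep ->]; elim: p i ep => //= j' p IH i /andP[eij ep].
  by rewrite (iB _ _ eij) (IH j').
(* [part i] is the connected part of [w'] at [i], padded with [tnth w' i]. *)
pose part i := [tuple if connect e i j then tnth w' j else tnth w' i | j < m].
pose l := [seq i <- enum 'I_m | (tnth w' i \notin b)].
pose g i := typ B (part i).
have [|||||W [W1 W2 W3]] :=
  @frequent_scattered d (k + m * m) C _ l g T A x0 [set x in a].
- exact: dA.
- by rewrite filter_uniq // enum_uniq.
- move=> i; rewrite mem_filter => /andP[ib _].
  apply: subsetP (Bb _ ib) _ _; apply/featP; exists (part i) => //.
  move=> _ /tnthP[j ->]; rewrite tnth_mktuple; case: ifP => [ij|_].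
    exact: connect_ball ij.
  by apply: subsetP (ball_leq _ _ (leq0n _)) _ _; rewrite inE.
- apply: leq_add.
    by rewrite cardsE; apply: leq_trans (card_size _) _; rewrite size_tuple.
  rewrite leq_mul2l; apply/orP; right; rewrite size_filter.
  by apply: leq_trans (count_size _ _) _; rewrite size_enum_ord.
- exact: leC.
(* All indices with value in [b] share one label, since entries of [a] may be adjacent in [A]
   through elements outside the pattern. Other indices are labelled by their connected part. *)
pose q i : option 'I_m :=
  if tnth w' i \in b then None else Some (fingraph.root e i).
pose w := [tuple if q i is Some c then tnth (W c) i else h (tnth w' i) | i < m].
have rootl i : tnth w' i \notin b -> fingraph.root e i \in l.
  move=> ib; rewrite mem_filter mem_enum andbT -(eb i) //; exact: connect_root.
have qA i j : adj A (tnth w i) (tnth w j) -> q i = q j.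
  rewrite !tnth_mktuple /q; case: ifPn => ib; case: ifPn => jb //.
  - have [c ->] := tnthP _ _ ib; rewrite hb => ac.
    have := W2 _ (tnth a c) (tnth (W (fingraph.root e j)) j) (rootl _ jb).
    by rewrite inE !mem_tnth ac; move=> /(_ isT isT).
  - have [c ->] := tnthP _ _ jb; rewrite hb => ac.
    have := W2 _ (tnth a c) (tnth (W (fingraph.root e i)) i) (rootl _ ib).
    by rewrite inE !mem_tnth adj_sym ac; move=> /(_ isT isT).
  - move=> aij; congr Some; apply/eqP; apply: contraTT aij => rij.
    by apply: (W3 _ _ _ _ (rootl _ ib) (rootl _ jb) rij); apply: mem_tnth.
have qB i j : adj B (tnth w' i) (tnth w' j) -> q i = q j.
  move=> aij; rewrite /q (iB _ _ aij); case: ifP => // _; congr Some.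
  by apply/(fingraph.rootP e_sym)/connect1.
have loc c : agree [pred i | q i == c] A w B w'.
  case: c => [c|].
    have qc i : q i == Some c -> tnth w i = tnth (W c) i /\
        tnth w' i = tnth (part c) i /\ c \in l.
      rewrite !tnth_mktuple /q; case: ifPn => // ib /eqP[<-]; split=> //.
      by rewrite e_sym connect_root; split=> //; apply: rootl.
    have WB : c \in l -> agree predT A (W c) B (part c).
      by move=> cl; apply/typP; rewrite W1.
    split=> [i j /qc[-> [-> cl]] /qc[-> [-> _]]|r t /allP tc].
      by have [-> //] := WB cl.
    have [i0 /tc/qc[_ [_ cl]]] := ar_tuple_ex t.
    have E1 : map_tuple (tnth w) t = map_tuple (tnth (W c)) t.
      apply: val_inj; apply/eq_in_map => i /tc/qc[] //.
    have E2 : map_tuple (tnth w') t = map_tuple (tnth (part c)) t.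
      by apply: val_inj; apply/eq_in_map => i /tc/qc[_ []].
    by rewrite E1 E2; have [_ -> //] := WB cl; rewrite all_predT.
  have qN i : q i == None -> tnth w i = h (tnth w' i) /\ tnth w' i \in b.
    by rewrite tnth_mktuple /q; case: ifPn.
  split=> [i j /qN[-> ib] /qN[-> jb]|r t /allP tN].
    by apply/eqP/eqP => [/h_inj-> //|->].
  rewrite -hrel; last by move=> _ /mapP[i it ->]; case: (qN _ (tN _ it)).
  apply: (congr1 (fun z => z \in A r)); apply: eq_from_tnth => i.
  have [+ _] := qN _ (tN _ (mem_tnth i t)).
  by move: (tnth w) => u; rewrite !tnth_map.
rewrite -(agree_sat qf (agree_glue qA qB loc)).
(* It remains to see that [w] ends with [a]: the last [k] entries of [w'] are those of [b], which
   [h] maps to [a]. *)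
apply: (fE _ _ _).1 fa _ _; apply/suffixP; exists (take (m - k) w).
rewrite -{1}(cat_take_drop (m - k) w); congr cat.
have sy : size y' = m - k.
  have := congr1 size def_w'; rewrite size_cat !size_tuple => ->.
  by rewrite addnK.
apply: (@eq_from_nth _ x0); first by rewrite size_drop !size_tuple subKn.
move=> i; rewrite size_drop size_tuple subKn // => ik.
have im : m - k + i < m by lia.
rewrite nth_drop -[m - k + i]/(val (Ordinal im)) -tnth_nth tnth_mktuple.
have w'i : tnth w' (Ordinal im) = tnth b (Ordinal ik).
  rewrite (tnth_nth (tnth b (Ordinal ik))) def_w' nth_cat sy /=.
  rewrite ltnNge leq_addr /=.
  by rewrite addKn [RHS](tnth_nth (tnth b (Ordinal ik))).
by rewrite /q w'i mem_tnth hb (tnth_nth x0).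
Qed.

End Types.

(** * Turning a structure into a model by few edits *)

Section Editing.
Variable s : signature.

(** Every tuple in the difference meets [Z], and through each element of [Z] pass at most [d] tuples
    of [A] and [d] of [B]. *)
Lemma diff_size_incident d (T : finType) (A B : structure s T) (Z : {set T}) :
  degree_le d A -> degree_le d B ->
  (forall (r : s) (t : (ar r).-tuple T), [disjoint t & Z] ->
     (t \in A r) = (t \in B r)) ->
  diff_size A B <= 2 * d * #|Z|.
Proof.
move=> /forallP dA /forallP dB AB.
pose D := \bigcup_(z in Z) (incident A z :|: incident B z).
apply: leq_trans (_ : #|D| <= _); last first.
  rewrite mulnC; apply: leq_card_bigcup_const => z _.
  by apply: leq_trans (leq_card_setU _ _) _; rewrite mul2n -addnn leq_add.
rewrite /diff_size; under eq_bigr do rewrite -sum1_card.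
rewrite sig_big_dep /= -sum1_card.
rewrite [leqLHS]big_mkcond [leqRHS]big_mkcond; apply: leq_sum => -[r t] _ /=.
case: ifP => // tAB; suff -> : existT _ r t \in D by [].
have : ~~ [disjoint t & Z].
  by apply: contraL tAB => /AB E; rewrite !inE E andNb.
rewrite disjoint_has negbK => /hasP[z zt zZ]; apply/bigcupP; exists z => //.
move: tAB; rewrite !inE /= zt !andbT.
by case/orP=> /andP[_ ->]; rewrite ?orbT.
Qed.

(** The tuples through [x] are mapped to tuples through [y]. Injectivity of [h] on [P] suffices
    because these tuples live on [P]. *)
Lemma card_incident_inj (T U : finType) (A : structure s T) (B : structure s U)
    d x y (h : T -> U) (P : {pred T}) :
  {in P &, injective h} ->
  (forall (r : s) (t : (ar r).-tuple T), t \in A r -> x \in t ->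
     {subset t <= P} /\ map_tuple h t \in B r) ->
  h x = y -> #|incident B y| <= d -> #|incident A x| <= d.
Proof.
move=> h_inj hAB <-; apply: leq_trans.
pose G (f : fact s T) : fact s U := existT _ (tag f) (map_tuple h (tagged f)).
rewrite -(card_in_imset (f := G)).
  apply/subset_leq_card/subsetP => _ /imsetP[[r t] + ->].
  rewrite !inE /= => /andP[tA xt]; have [_ ->] := hAB _ _ tA xt.
  by rewrite map_f.
move=> [r t] [r' t']; rewrite !inE /= => /andP[tA xt] /andP[t'A xt'].
move=> E; have r'r : r = r' := congr1 tag E; subst r'.
have {}E : map_tuple h t = map_tuple h t' := eq_from_Tagged E.
congr existT; apply: val_inj.
have [tP _] := hAB _ _ tA xt; have [t'P _] := hAB _ _ t'A xt'.
by apply: (inj_in_map h_inj) (congr1 val E); [apply/allP | apply/allP].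
Qed.

(** [B] consists of a copy of the pattern on an initial segment [K], of the tuples of [A] avoiding
    [K] and the violating elements, and of loops at the violating elements outside [K]. Off [K],
    features in [B] are contained in features of non-violating elements of [A], so goodness of [U]
    applies. *)
Lemma good_edit m d k (f : formula s k) (U : {set mtype s m}) n
    (A : structure s 'I_n.+1) :
  degree_le d A -> good d f U -> k <= n.+1 ->
  #|[set a | ~~ (feat m A a \subset U)]| < n.+1 ->
  exists B : structure s 'I_n.+1, [/\ degree_le d B,
    exists b : k.-tuple 'I_n.+1, sat B f b &
    diff_size A B <= 2 * d * (#|[set a | ~~ (feat m A a \subset U)]| + k)].
Proof.
move=> dA [T0 [A0 [a0 [T0_gt0 dA0 goodU]]]] kn.
set bad := [set a | _] => lt_bad; have [x0 _] := card_gt0P T0_gt0.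
have [lam lamP] : exists lam, lam \notin bad.
  have : ~~ ([set: 'I_n.+1] \subset bad).
    apply: contraL lt_bad => /subset_leq_card.
    by rewrite cardsT card_ord -leqNgt.
  by case/subsetPn => lam _; exists lam.
(* Without repetitions, [h] identifies [K] with the distinct entries of the pattern. *)
pose u0 := undup a0.
have su0 : size u0 <= k by rewrite -(size_tuple a0) size_undup.
pose K : {set 'I_n.+1} := [set z : 'I_n.+1 | z < size u0].
pose h (z : 'I_n.+1) := nth x0 u0 z.
have h_inj : {in K &, injective h}.
  move=> x y; rewrite !inE => xK yK /eqP.
  by rewrite nth_uniq ?undup_uniq // => /eqP/val_inj.
(* Violating elements become copies of [lam]; [lab] keeps them disconnected. *)
pose g z := if z \in bad then lam else z.
have g_bad z : g z \notin bad by rewrite /g; case: ifP => // ->.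
pose lab z := if z \in bad then Some z else None.
have lab_inj x y : lab x = lab y -> g x = g y -> x = y.
  by rewrite /lab /g; case: ifP => _; case: ifP => _ // [].
pose inK r (t : (ar r).-tuple 'I_n.+1) :=
  all (mem K) t && (map_tuple h t \in A0 r).
(* Distinct elements share a label only if neither violates. Hence a tuple through a violating
   element is constant and imitates a loop at [lam], and all other tuples are those of [A]. *)
pose outK r (t : (ar r).-tuple 'I_n.+1) := [&& all (mem (~: K)) t,
  allrel (fun x y => lab x == lab y) t t & map_tuple g t \in A r].
pose B : structure s 'I_n.+1 :=
  [ffun r : s => [set t : (ar r).-tuple 'I_n.+1 | inK r t || outK r t]].
have BE r t : (t \in B r) = inK r t || outK r t by rewrite ffunE inE.
have B_in r (t : (ar r).-tuple _) x : x \in t -> x \in K ->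
    (t \in B r) = inK r t.
  move=> xt xK; rewrite BE orbC.
  case: (boolP (outK r t)) => // /and3P[/allP tK _ _].
  by have := tK _ xt; rewrite inE /= inE xK.
have B_out r (t : (ar r).-tuple _) x : x \in t -> x \notin K ->
    (t \in B r) = outK r t.
  move=> xt xK; rewrite BE; case: (boolP (inK r t)) => // /andP[/allP tK _].
  by have := tK _ xt; rewrite /= (negPf xK).
(* A tuple of [B] lies in [K] or in one label class off [K]. There [h], respectively [g], is
   injective, so the degree bound is inherited from [A0], respectively [A]. *)
have dB : degree_le d B.
  apply/forallP => x; have [xK|xK] := boolP (x \in K).
    apply: (card_incident_inj (h := h) (P := mem K) h_inj _ erefl);
      last exact: (forallP dA0).
    by move=> r t tB xt; move: tB; rewrite (B_in _ _ _ xt xK) => /andP[/allP].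
  apply: (card_incident_inj (h := g) (P := [pred y | lab y == lab x])
    _ _ erefl); last exact: (forallP dA).
    by move=> y z /eqP ly /eqP lz; apply: lab_inj; rewrite ly.
  move=> r t tB xt; move: tB; rewrite (B_out _ _ _ xt xK).
  case/and3P=> _ /allrelP tl ->; split=> // y yt; exact: tl.
have adjB x y : adj B x y -> x \notin K ->
    [/\ y \notin K, lab x = lab y & adj A (g x) (g y)].
  move=> /adjP[->|[r [t [tB xt yt]]]] xK; first by split; rewrite ?adj_refl.
  move: tB; rewrite (B_out _ _ _ xt xK) => /and3P[/allP tK /allrelP tl tA].
  have := tK _ yt; rewrite /= inE => yK; split=> //; first exact/eqP/tl.
  by apply/adjP; right; exists r, (map_tuple g t); rewrite tA !map_f.
have adjK x y : adj B x y -> (x \in K) = (y \in K).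
  move=> xy; have [yK|yK] := boolP (y \in K); last first.
    by rewrite adj_sym in xy; case/adjB: xy => // /negPf.
  by apply: contraTT yK => /(adjB _ _ xy)[].
have ballB r x y : x \notin K -> y \in ball B r [set x] ->
    [/\ y \notin K, lab x = lab y & g y \in ball A r [set g x]].
  move=> xK; elim: r y => [|r IH] y.
    by move/set1P->; split=> //; apply: set11.
  rewrite ballS => /neighP[z /IH[zK lz zA]] /adjB/(_ zK)[yK lzy zy].
  by split=> //; [rewrite lz | apply/neighP; exists (g z)].
pose b := map_tuple (fun x => inord (index x u0) : 'I_n.+1) a0.
have idx x : x \in a0 -> index x u0 < size u0 by rewrite index_mem mem_undup.
have hK x : x \in a0 -> h (inord (index x u0)) = x.
  move=> xa; rewrite /h inordK; first by rewrite nth_index ?mem_undup.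
  exact: leq_trans (idx _ xa) (leq_trans su0 kn).
have bK x : (x \in b) = (x \in K).
  apply/mapP/idP => [[y ya ->]|].
    rewrite inE inordK ?idx //.
    exact: leq_trans (idx _ ya) (leq_trans su0 kn).
  rewrite inE => xK; exists (h x); first by rewrite -mem_undup mem_nth.
  by apply: val_inj; rewrite /= /h index_uniq ?undup_uniq // inord_val.
exists B; split=> //; last first.
  apply: leq_trans (diff_size_incident (Z := bad :|: K) dA dB _) _.
    move=> r t tZ; have [x xt] := ar_tuple_ex t.
    have tZ' y : y \in t -> (y \notin K) && (y \notin bad).
      by move=> /(disjointFr tZ); rewrite inE => /norP[-> ->].
    have /andP[xK _] := tZ' _ xt.
    rewrite (B_out _ _ _ xt xK) /outK.
    have -> : map_tuple g t = t.
      apply: eq_from_tnth => i; rewrite tnth_map /g.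
      by have /andP[_ /negPf->] := tZ' _ (mem_tnth i t).
    have -> : all (mem (~: K)) t.
      by apply/allP => y /tZ' /andP[yK _]; rewrite /= inE.
    suff -> : allrel (fun x y => lab x == lab y) t t by [].
    apply/allrelP => y z /tZ' /andP[_ yb] /tZ' /andP[_ zb].
    by rewrite /lab (negPf yb) (negPf zb).
  rewrite leq_mul2l; apply/orP; right.
  apply: leq_trans (leq_card_setU _ _) _; rewrite leq_add2l.
  apply: leq_trans su0; rewrite cardE -(size_map val).
  rewrite -[leqRHS](size_iota 0); apply: uniq_leq_size.
    by rewrite map_inj_uniq ?enum_uniq //; apply: val_inj.
  by move=> _ /mapP[z zK ->]; move: zK; rewrite mem_enum mem_iota inE.
exists b; apply: goodU.
- by move=> x y xy; rewrite !bK; apply: adjK.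
- split=> [i j _ _|r t _].
    rewrite !tnth_map; apply/eqP/eqP => [->//|/(congr1 h)].
    by rewrite !hK ?mem_tnth.
  have [i it] := ar_tuple_ex t.
  have bt : tnth b i \in map_tuple (tnth b) t by apply: map_f.
  rewrite (B_in _ _ _ bt); last by rewrite -bK mem_tnth.
  rewrite /inK.
  have -> : all (mem K) (map_tuple (tnth b) t).
    by apply/allP => _ /mapP[j _ ->]; rewrite /= -bK mem_tnth.
  apply: (congr1 (fun z => z \in A0 r)); apply: eq_from_tnth => j.
  by rewrite !tnth_map hK ?mem_tnth.
(* A tuple [w] in the ball of [x] stays off [K] and in one label class, so [g] preserves its type
   and sends it into the ball of [g x]. Losing the tuples of [A] that meet [K] only shrinks
   balls. *)
move=> x; rewrite bK => xK; apply/subsetP => _ /featP[w wx <-].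
have wP i := ballB _ _ _ xK (wx _ (mem_tnth i w)).
have -> : typ B w = typ A (map_tuple g w).
  apply/typP; split=> [i j _ _|r t _].
    rewrite !tnth_map; apply/eqP/eqP => [->//|]; apply: lab_inj.
    by have [_ <- _] := wP i; have [_ <- _] := wP j.
  have [i it] := ar_tuple_ex t.
  have wt : tnth w i \in map_tuple (tnth w) t by apply: map_f.
  have [wK _ _] := wP i; rewrite (B_out _ _ _ wt wK) /outK.
  have -> : all (mem (~: K)) (map_tuple (tnth w) t).
    by apply/allP => _ /mapP[j _ ->]; rewrite /= inE; case: (wP j).
  have -> : allrel (fun x y => lab x == lab y) (map_tuple (tnth w) t)
      (map_tuple (tnth w) t).
    apply/allrelP => _ _ /mapP[j _ ->] /mapP[j' _ ->].
    by have [_ <- _] := wP j; have [_ <- _] := wP j'.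
  apply: (congr1 (fun z => z \in A r)); apply: eq_from_tnth => j.
  by rewrite !tnth_map.
have : feat m A (g x) \subset U by have := g_bad x; rewrite inE negbK.
move/subsetP; apply; apply/featP; exists (map_tuple g w); last by [].
by move=> _ /mapP[y /wx/(ballB _ _ _ xK)[_ _ yA] ->].
Qed.

End Editing.

(** * Exploring balls through the oracle *)

Section Exploration.
Variables (s : signature) (d n : nat).
Implicit Types (A : structure s 'I_n) (L : listing s n) (X : {set 'I_n}).
Implicit Types (F : {set fact s 'I_n}).

Definition facts_at A X : {set fact s 'I_n} := \bigcup_(x in X) incident A x.

Definition structure_of F : structure s 'I_n :=
  [ffun r : s => [set t : (ar r).-tuple 'I_n | existT _ r t \in F]].

Definition oset (T : finType) (o : option T) : {set T} :=
  if o is Some x then [set x] else set0.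

Fixpoint query_list (l : seq ('I_n * 'I_d)) F
    (k : {set fact s 'I_n} -> algorithm s d n) : algorithm s d n :=
  if l is p :: l' then
    Query p.1 p.2 (fun o => query_list l' (F :|: oset o) k)
  else k F.

Definition slots X : seq ('I_n * 'I_d) :=
  [seq (x, i) | x <- enum X, i <- enum 'I_d].

(** The first [r] rounds enlarge [X] by one step each; the last collects the tuples at the final
    ball. Elements already seen are queried again in each round, which costs at most a factor
    [r.+1]. *)
Fixpoint explore r X (k : {set fact s 'I_n} -> algorithm s d n) :
    algorithm s d n :=
  query_list (slots X) set0 (fun F =>
    if r is r'.+1 then
      explore r' (X :|: \bigcup_(f in F) [set y in tagged f]) k
    else k F).

Lemma query_listE L (l : seq ('I_n * 'I_d)) F k :
  let F' := F :|: \bigcup_(p <- l) oset (onth (L p.1) p.2) in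
  (forall b, outcome_prob L b (query_list l F k) = outcome_prob L b (k F')) /\
  num_queries L (query_list l F k) = size l + num_queries L (k F').
Proof.
elim: l F => [|p l IH] F /=; first by rewrite big_nil setU0.
have [IH1 IH2] := IH (F :|: oset (onth (L p.1) p.2)).
by rewrite big_cons setUA; split=> [b|]; rewrite ?IH1 ?IH2.
Qed.

Lemma size_slots X : size (slots X) = #|X| * d.
Proof. by rewrite size_allpairs -cardE size_enum_ord. Qed.

(** By the degree bound [d] slots exhaust the list of an element, and collecting a set forgets the
    order of the listing. *)
Lemma slots_facts A L X : degree_le d A -> listing_of A L ->
  \bigcup_(p <- slots X) oset (onth (L p.1) p.2) = facts_at A X.
Proof.
move=> /forallP dA LA; rewrite big_allpairs_dep /=.
rewrite /facts_at big_enum /=; apply: eq_bigr => x _.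
apply/setP => f; rewrite big_enum /= -[RHS]mem_enum -(perm_mem (LA x)).
apply/bigcupP/idP => [[i _]|/onthP[i Li]].
  rewrite /oset; case E: onth => [g|]; rewrite inE // => /eqP->.
  by apply/onthP; exists i.
have ltid : i < d.
  apply: leq_trans (dA x); rewrite cardE -(perm_size (LA x)) -onthTE Li //.
by exists (Ordinal ltid) => //=; rewrite Li inE.
Qed.

Lemma neigh_facts A X :
  X :|: \bigcup_(f in facts_at A X) [set y in tagged f] = neigh A X.
Proof.
apply/setP => y; rewrite inE; apply/orP/neighP.
  case=> [yX|/bigcupP[f /bigcupP[x xX fx]]].
    by exists y; rewrite ?adj_refl.
  rewrite inE => yf; exists x => //; apply/orP; right.
  by apply/existsP; exists f; rewrite fx.
case=> x xX /orP[/eqP<-|/existsP[f /andP[fx yf]]]; first by left.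
by right; apply/bigcupP; exists f; [apply/bigcupP; exists x | rewrite inE].
Qed.

Lemma outcome_prob_explore A L r X k b : degree_le d A -> listing_of A L ->
  outcome_prob L b (explore r X k) =
  outcome_prob L b (k (facts_at A (ball A r X))).
Proof.
move=> dA LA; elim: r X => [|r IH] X /=; rewrite (query_listE _ _ _ _).1;
  rewrite set0U (slots_facts _ dA LA) //.
by rewrite neigh_facts IH -ballSr.
Qed.

Lemma num_queries_explore A L r X k : degree_le d A -> listing_of A L ->
  num_queries L (explore r X k) <= r.+1 * (#|ball A r X| * d) +
    num_queries L (k (facts_at A (ball A r X))).
Proof.
move=> dA LA; elim: r X => [|r IH] X /=; rewrite (query_listE _ _ _ _).2;
  rewrite set0U (slots_facts _ dA LA) // size_slots ?mul1n //.
rewrite neigh_facts [r.+2 * _]mulSn -addnA; apply: leq_add; last first.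
  by apply: leq_trans (IH _) _; rewrite -ballSr.
rewrite leq_mul2r; apply/orP; right; apply: subset_leq_card.
exact: ball_leq (leq0n r.+1).
Qed.

Lemma structure_of_facts A X (r : s) (t : (ar r).-tuple 'I_n) x :
  x \in t -> x \in X -> (t \in structure_of (facts_at A X) r) = (t \in A r).
Proof.
move=> xt xX; rewrite ffunE inE; apply/bigcupP/idP => [[y _]|tA].
  by rewrite inE => /andP[].
by exists x; rewrite // inE /= tA.
Qed.

Lemma structure_of_sub A X (r : s) (t : (ar r).-tuple 'I_n) :
  t \in structure_of (facts_at A X) r -> t \in A r.
Proof. by rewrite ffunE inE => /bigcupP[x _]; rewrite inE => /andP[]. Qed.

Lemma structure_of_setT A : structure_of (facts_at A setT) = A.
Proof.
apply/ffunP => r; apply/setP => t; have [x xt] := ar_tuple_ex t.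
by rewrite (structure_of_facts _ xt) ?in_setT.
Qed.

(** All tuples meeting the ball are known, so adjacency at its elements is unchanged. Hence balls up
    to radius [m] grow in the same way, and types of tuples inside agree. *)
Lemma feat_facts m A a :
  feat m (structure_of (facts_at A (ball A m [set a]))) a = feat m A a.
Proof.
set X := ball A m [set a].
have : forall r (t : (ar r).-tuple 'I_n), t \in structure_of (facts_at A X) r ->
    t \in A r by move=> r t; apply: structure_of_sub.
have : forall r (t : (ar r).-tuple 'I_n) x, x \in t -> x \in X ->
    (t \in structure_of (facts_at A X) r) = (t \in A r).
  by move=> r t x; apply: structure_of_facts.
move: (structure_of _) => A' A'E A'_sub.
have adjE x y : x \in X -> adj A' x y = adj A x y.
  move=> xX; apply/adjP/adjP => -[|[r [t [tA xt yt]]]]; try (by left); right.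
    by exists r, t; split=> //; apply: A'_sub tA.
  by exists r, t; split; rewrite // (A'E _ _ _ xt).
have ballE i : i <= m -> ball A' i [set a] = ball A i [set a].
  elim: i => [_|i IH im]; first exact: erefl.
  have iX := subsetP (ball_leq A [set a] (ltnW im)).
  rewrite !ballS (IH (ltnW im)); apply/setP => y.
  apply/neighP/neighP => -[x xB xy]; exists x; try exact: xB.
    by rewrite -(adjE _ _ (iX _ xB)).
  by rewrite (adjE _ _ (iX _ xB)).
have typE (w : m.-tuple 'I_n) : {subset w <= X} -> typ A' w = typ A w.
  move=> wX; apply/typP; split=> // r t _; have [i it] := ar_tuple_ex t.
  by apply: (A'E _ _ (tnth w i)); [apply: map_f | apply/wX/mem_tnth].
apply/setP => ty; apply/featP/featP; rewrite ballE // => -[w wX <-];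
  by exists w; rewrite ?typE.
Qed.

End Exploration.

(** * The sampling algorithm and its acceptance probability *)

Section Sampling.
Variables (s : signature) (d n m : nat) (dec : pred {set mtype s m}).

(** Only queries are counted, so the verdict may be any predicate of the collected features;
    goodness is plugged in by classical decision. *)
Fixpoint sample_feats (N : nat) (acc : {set mtype s m}) : algorithm s d n.+1 :=
  if N is N'.+1 then
    Sample (fun a => explore m [set a] (fun F =>
      sample_feats N' (acc :|: feat m (structure_of F) a)))
  else Output s d n.+1 (dec acc).

Variables (A : structure s 'I_n.+1) (L : listing s n.+1).
Hypotheses (dA : degree_le d A) (LA : listing_of A L).

Local Open Scope ring_scope.

Lemma sample_featsS N acc b :
  outcome_prob L b (sample_feats N.+1 acc) =
  (\sum_a outcome_prob L b (sample_feats N (acc :|: feat m A a))) / n.+1%:R.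
Proof.
rewrite /=; congr (_ / _); apply: eq_bigr => a _.
by rewrite (outcome_prob_explore _ _ _ _ dA LA) feat_facts.
Qed.

Lemma outcome_prob_ge0 b (M : algorithm s d n.+1) : 0 <= outcome_prob L b M.
Proof.
elim: M => [c|a i k IH|j k IH] /=; [exact: ler0n | exact: IH |].
by rewrite divr_ge0 ?ler0n // sumr_ge0.
Qed.

Lemma outcome_prob_total (M : algorithm s d n.+1) :
  outcome_prob L true M + outcome_prob L false M = 1.
Proof.
elim: M => [c|a i k IH|j k IH] /=; first by case: c; rewrite ?addr0 ?add0r.
  exact: IH.
rewrite -mulrDl -big_split /= (eq_bigr (fun=> 1)) //.
by rewrite sumr_const card_ord divff ?pnatr_eq0.
Qed.

Lemma num_queries_sample_feats N acc :
  (num_queries L (sample_feats N acc) <=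
     N * (m.+1 * (growth s d ^ m * d)))%N.
Proof.
elim: N acc => [|N IH] acc //=; apply/bigmax_leqP => a _.
apply: leq_trans (num_queries_explore _ _ _ dA LA) _.
rewrite [leqRHS]mulSn; apply: leq_add; last exact: IH.
rewrite leq_mul2l leq_mul2r /=; apply/orP; right.
by have := card_ball m [set a] dA; rewrite cards1 mul1n.
Qed.

(** Union bound over the [N] samples: as long as none violates [V], the accumulated set stays inside
    [V]. *)
Lemma sample_feats_accept N (V acc : {set mtype s m}) :
  (forall U : {set mtype s m}, U \subset V -> dec U) -> acc \subset V ->
  1 - (N * #|[set a | ~~ (feat m A a \subset V)]|)%:R / n.+1%:R
    <= outcome_prob L true (sample_feats N acc).
Proof.
move=> decV; set Z := [set a | _].
elim: N acc => [|N IH] acc accV.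
  by rewrite mul0n mul0r subr0 /= decV.
rewrite sample_featsS.
have n_gt0 : 0 < n.+1%:R :> rat by rewrite ltr0n.
rewrite ler_pdivlMr // mulrBl mul1r divfK ?gt_eqF //.
(* For [a] in [Z] the summand is at most 0, so nonnegativity of the probability suffices; elsewhere
   the induction hypothesis applies. *)
apply: (@le_trans _ _ (\sum_(a : 'I_n.+1)
  ((1 - (N * #|Z|)%:R / n.+1%:R) - (a \in Z)%:R))).
  rewrite sumrB sumr_const card_ord -[X in _ <= X - _]mulr_natr mulrBl mul1r.
  rewrite divfK ?gt_eqF //.
  rewrite -natr_sum -big_mkcond /= sum1_card mulSn natrD.
  lra.
apply: ler_sum => a _; have [aZ|aZ] := boolP (a \in Z).
  apply: le_trans (outcome_prob_ge0 _ _).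
  by rewrite lerBlDr add0r lerBlDr lerDl divr_ge0 ?ler0n.
rewrite subr0; apply: IH; rewrite subUset accV.
by move: aZ; rewrite inE negbK.
Qed.

(** Union bound over the accepted values [U] of the final set: reaching [U] forces every sample to
    have its feature inside [U], which has probability at most [q] each time. Summing only over [U]
    containing [acc] carries the induction. *)
Lemma sample_feats_reject N (q : rat) (acc : {set mtype s m}) :
  0 <= q ->
  (forall U : {set mtype s m}, dec U ->
     #|[set a | feat m A a \subset U]|%:R <= q * n.+1%:R) ->
  outcome_prob L true (sample_feats N acc)
    <= \sum_(U : {set mtype s m} | dec U && (acc \subset U)) q ^+ N.
Proof.
move=> q_ge0 decq; elim: N acc => [|N IH] acc.
  rewrite /=; case: (boolP (dec acc)) => dacc; last first.
    by apply: sumr_ge0 => U _; rewrite expr0.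
  by rewrite (bigD1 acc) /= ?dacc ?subxx // expr0 lerDl sumr_ge0.
rewrite sample_featsS.
have n_gt0 : 0 < n.+1%:R :> rat by rewrite ltr0n.
rewrite ler_pdivrMr //.
apply: le_trans (ler_sum _ (fun a _ => IH (acc :|: feat m A a))) _.
under eq_bigr do rewrite big_mkcond.
(* For fixed [U], only those [a] whose feature lies in [U] contribute. *)
rewrite exchange_big /= mulr_suml [leRHS]big_mkcond /=.
apply: ler_sum => U _; case: (boolP (dec U)) => dU /=; last first.
  by rewrite big1.
case: (boolP (acc \subset U)) => accU; last first.
  by rewrite big1 // => a _; rewrite subUset (negPf accU).
under eq_bigr do rewrite subUset accU /=.
rewrite -big_mkcond /= sumr_const -[_ *+ _]mulr_natl exprS mulrAC.
rewrite ler_wpM2r ?exprn_ge0 //; apply: le_trans (decq _ dU).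
by rewrite cardsE.
Qed.

End Sampling.

(** The induction step is [(1 - x) * (1 + N.+1 * x) <= 1 + N * x]. This decay of the power is enough
    for rejection and needs no exponential function. *)
Lemma bernoulli_inverse (F : realDomainType) (x : F) (N : nat) :
  (0 <= x <= 1)%R -> ((1 - x) ^+ N * (1 + N%:R * x) <= 1)%R.
Proof.
move=> /andP[x_ge0 x_le1]; elim: N => [|N IH].
  by rewrite mul0r addr0 mulr1.
apply: le_trans IH; rewrite exprSr -mulrA.
apply: ler_wpM2l; first by rewrite exprn_ge0 // subr_ge0.
have : (0 <= N%:R :> F)%R by rewrite ler0n.
by rewrite -natr1; nra.
Qed.

Lemma eps_closeI (R : realType) (eps : R) (s : signature) (d : nat)
    (P : property s d) (T : finType) (A B : structure s T) :
  P T B -> ((diff_size A B)%:R / (d * #|T|)%:R <= eps)%R -> eps_close eps P A.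
Proof.
by move=> PB le; apply: le_trans (bigmin_le_cond _ _ PB) _; rewrite lee_fin.
Qed.

Lemma diff_size_refl (s : signature) (T : finType) (A : structure s T) :
  diff_size A A = 0.
Proof. by rewrite /diff_size big1 // => r _; rewrite setDv setU0 cards0. Qed.

(** Radius 0 around all elements already reveals every tuple, so the answer is exact. *)
Lemma explore_all_tester (R : realType) (eps : R) (s : signature) (d n : nat)
    (P : property s d) : (0 < eps)%R ->
  tester eps P (explore 0 setT (fun F => Output s d n (P _ (structure_of F)))).
Proof.
move=> eps_gt0 A L dA LA.
rewrite !(outcome_prob_explore _ _ _ _ dA LA) /= structure_of_setT.
split=> [->|far]; first by rewrite eqxx /=; lra.
have -> : P 'I_n A = false; last by rewrite eqxx /=; lra.
apply: contraNF far => PA; apply: eps_closeI PA _.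
by rewrite diff_size_refl mul0r ltW.
Qed.

Lemma complement_ge (F : realFieldType) (p p' y : F) :
  (y * 3%:R <= 1 -> p <= y -> p + p' = 1 -> 2%:R / 3%:R <= p')%R.
Proof. by move=> *; lra. Qed.

(** * Correctness of sampling on large inputs *)

Section LargeStructures.
Variables (R : realType) (eps : R) (s : signature) (d : nat).
Variables (phi : sentence s) (k m : nat).
Variables (f : formula s k) (chi : formula s m).
Hypotheses (eps01 : (0 < eps < 1)%R) (km : k <= m) (qf : quantifier_free chi).
Hypothesis phiE : forall (T : finType) (A : structure s T),
  0 < #|T| -> models A phi <-> exists v : k.-tuple T, sat A f v.
Hypothesis fE : forall (T : finType) (A : structure s T) (v : k.-tuple T),
  sat A f v <-> forall w : m.-tuple T, suffix v w -> sat A chi w.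

(** [C] is the threshold required by [good_frequent], and [c] exceeds [1 / eps]. [N] is chosen such
    that [N / (4 * c)] is three times the number of sets of types. *)
Let C := (k + m * m) * growth s d ^ m.+1.
Let c := (Num.truncn eps^-1%R).+1.
Let N := 4 * c * (3 * #|{set mtype s m}|).

(** Otherwise both [4 * c * k] and [4 * c] times the number of violating elements are at most
    [n.+1], and the edits of [good_edit] number at most [d * n.+1 / c], putting a model within
    distance [1 / c <= eps]. *)
Lemma far_bad n (A : structure s 'I_n.+1) (U : {set mtype s m}) :
  4 * c * k <= n.+1 -> degree_le d A ->
  eps_far eps (models_property d phi) A -> good d f U ->
  n.+1 < 4 * c * #|[set a | ~~ (feat m A a \subset U)]|.
Proof.
move=> len dA far gU; set bad := #|_|; rewrite ltnNge; apply/negP => le_bad.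
have c_gt0 : 0 < c by [].
have [|| B [dB [b fb] diff]] := good_edit (m := m) dA gU.
- by apply: leq_trans len; rewrite leq_pmull // muln_gt0.
- by rewrite -/bad; nia.
case/negP: far; apply: (@eps_closeI _ _ _ _ _ _ A B).
  rewrite /= /models_pred dB /=; apply/phiE; last by exists b.
  by rewrite card_ord.
have eps_gt0 : (0 < eps)%R by case/andP: eps01.
have eps_c : (1 <= c%:R * eps :> R)%R.
  rewrite -ler_pdivrMr // mul1r; apply/ltW/truncnS_gt.
(* For [d = 0] the quotient divides by zero and equals 0. *)
rewrite card_ord; have [->|d_gt0] := posnP d.
  by rewrite mul0n invr0 mulr0 ltW.
rewrite ler_pdivrMr ?ltr0n ?muln_gt0 ?d_gt0 //.
have le : c * diff_size A B <= d * n.+1.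
  have : c * diff_size A B <= c * (2 * d * (bad + k)).
    by rewrite leq_mul2l diff orbT.
  by nia.
rewrite -(ler_nat R) natrM in le.
rewrite -(ler_pM2l (_ : 0 < c%:R)%R) ?ltr0n //; apply: le_trans le _.
by rewrite mulrA ler_peMl // ler0n.
Qed.

Lemma sample_feats_tester n :
  3 * N * (#|mtype s m| * C) + 4 * c * k <= n.+1 ->
  tester eps (models_property d phi)
    (sample_feats d n (fun U : {set mtype s m} => `[< good d f U >]) N set0).
Proof.
move=> len A L dA LA.
have n_gt0 : (0 < n.+1%:R :> rat)%R by rewrite ltr0n.
split=> [/andP[_ /phiE[|a fa]]|far].
- by rewrite card_ord.
(* Completeness: all subsets of the frequent types are accepted, and a sample with an infrequent
   type occurs with probability at most 1/3. *)
- have gV : good d f (frequent m C A).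
    by apply: (good_frequent km qf fE _ _ dA fa); rewrite ?card_ord.
  have decV (U : {set mtype s m}) :
      U \subset frequent m C A -> `[< good d f U >].
    by move=> UV; apply/asboolP; apply: good_sub gV.
  apply: le_trans (sample_feats_accept dA LA N decV (sub0set _)).
  set z := #|_|; have z_le : z <= #|mtype s m| * C by exact: card_infrequent.
  have : 3 * (N * z) <= n.+1.
    apply: leq_trans (leq_trans (leq_addr _ _) len).
    by rewrite mulnA leq_mul2l z_le orbT.
  rewrite -(ler_nat rat) natrM => le.
  have : ((N * z)%:R / n.+1%:R <= 3%:R^-1 :> rat)%R.
    by rewrite ler_pdivrMr // mulrC ler_pdivlMr // mulrC.
  by move: ((N * z)%:R / _)%R => y; lra.
(* Soundness: for each good [U] a sample has its feature in [U] with probability at most [1 - x].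
   With [M] sets of types, [N * x = 3 * M], so the union bound gives at most [M / (1 + 3 * M)],
   below 1/3. *)
pose x : rat := ((4 * c)%:R^-1)%R.
have c4_gt0 : (0 < (4 * c)%:R :> rat)%R by rewrite ltr0n.
have x01 : (0 <= x <= 1)%R by rewrite invr_ge0 ler0n invf_le1 // ler1n.
case/andP: (x01) => x_ge0 x_le1.
have q_ge0 : (0 <= 1 - x)%R by rewrite subr_ge0.
have decq (U : {set mtype s m}) : `[< good d f U >] ->
    (#|[set a | feat m A a \subset U]|%:R <= (1 - x) * n.+1%:R)%R.
  move=> /asboolP gU; have := far_bad (leq_trans (leq_addl _ _) len) dA far gU.
  set bad := [set a | ~~ _] => lt_bad.
  have -> : [set a | feat m A a \subset U] = ~: bad.
    by apply/setP => a; rewrite !inE negbK.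
  have cC : (#|~: bad|%:R = n.+1%:R - #|bad|%:R :> rat)%R.
    have := congr1 (fun j => j%:R : rat)%R (cardsC bad); rewrite card_ord.
    by rewrite natrD; lra.
  rewrite cC mulrBl mul1r lerD2l lerN2 mulrC ler_pdivrMr //.
  by rewrite -natrM ler_nat mulnC ltnW.
have := sample_feats_reject dA LA N set0 q_ge0 decq.
rewrite (eq_bigl (fun U => `[< good d f U >])); last first.
  by move=> U; rewrite sub0set andbT.
rewrite sumr_const -[(_ *+ _)%R]mulr_natr => le.
have B := bernoulli_inverse N x01.
have le1 : ((1 - x) ^+ N * #|{set mtype s m}|%:R * 3%:R <= 1 :> rat)%R.
  apply: le_trans B; rewrite -mulrA.
  apply: ler_wpM2l; first by rewrite exprn_ge0.
  rewrite natrM mulrAC mulfV ?gt_eqF // mul1r mulnC natrM.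
  by rewrite lerDr.
have le2 : ((1 - x) ^+ N * #|[pred U : {set mtype s m} | `[< good d f U >]]|%:R
    <= (1 - x) ^+ N * #|{set mtype s m}|%:R :> rat)%R.
  by apply: ler_wpM2l; rewrite ?exprn_ge0 // ler_nat max_card.
exact: complement_ge le1 (le_trans le le2) (outcome_prob_total L _).
Qed.

End LargeStructures.

Theorem theorem6p1 (R : realType) (s : signature) (d : nat) (phi : sentence s) :
  Sigma2 phi -> testable R (models_property d phi).
Proof.
case=> psi /exists_forall_prefix_matrix[k [f [fp psiE]]] phipsi.
have [m [chi [km qf fE]]] := forall_prefix_matrix fp.
have phiE (T : finType) (A : structure s T) : 0 < #|T| ->
    models A phi <-> exists v : k.-tuple T, sat A f v.
  by move=> T_gt0; rewrite phipsi.
pose c (eps : R) := (Num.truncn eps^-1%R).+1.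
pose N eps := 4 * c eps * (3 * #|{set mtype s m}|).
pose n0 eps := 3 * N eps * (#|mtype s m| * ((k + m * m) * growth s d ^ m.+1)) +
  4 * c eps * k.
(* The first term pays for reading a small input completely, the second for [N] explorations of
   [m]-balls. *)
exists (fun eps => maxn (n0 eps * d) (N eps * (m.+1 * (growth s d ^ m * d)))).
(* The small case includes [n = 0], where [phiE] says nothing. *)
move=> n eps eps01; have [le_n|lt_n] := leqP n (n0 eps).
  exists (explore 0 setT (fun F => Output s d n
    (models_property d phi _ (structure_of F)))).
  split=> [|A L dA LA]; first by apply: explore_all_tester; case/andP: eps01.
  apply: leq_trans (num_queries_explore _ _ _ dA LA) _.
  by rewrite /= addn0 mul1n cardsT card_ord leq_max leq_mul2r le_n orbT.
case: n lt_n => // n lt_n.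
exists (sample_feats d n (fun U : {set mtype s m} => `[< good d f U >])
  (N eps) set0).
split=> [|A L dA LA]; last first.
  by rewrite leq_max (num_queries_sample_feats _ dA LA) orbT.
exact: (sample_feats_tester eps01 km qf phiE fE (ltnW lt_n)).
Qed.
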